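(* Suppose there exist constants $\delta>0$ and $0<\varepsilon<1$ such that $D(\delta|i,a,b)\le 1-\varepsilon$ for all $(i,a,b)\in S\times A\times B$. Given any $p\in\mathcal P(K)$, there exists $\sigma^*\in\Sigma$ such that $$V(p,i,\pi,\sigma^* )\le V^*(p,i),\qquad\forall\,\pi\in\Pi,\ i\in S,$$ i.e. $\sigma^*$ is an optimal policy for Player 2 in $G(p)$.
   Context: Model. $K,S,A,B$ are finite nonempty sets (game types, states, actions of Player 1, actions of Player 2). For a finite set $E$, $\mathcal P(E)$ is the set of probability distributions on $E$. $Q(\cdot,\cdot|i,a,b)$ is a semi-Markov kernel on $[0,\infty)\times S$ given $S\times A\times B$: for all $i,j,a,b$, $t\mapsto Q(t,j|i,a,b)$ is nondecreasing, right continuous, nonnegative, with $Q(0,j|i,a,b)=0$; $\sum_{j}Q(t,j|i,a,b)\le 1$ for all $t$; and $\sum_j\lim_{t\to\infty}Q(t,j|i,a,b)=1$. Put $D(t|i,a,b):=\sum_{j\in S}Q(t,j|i,a,b)$. The payoff rate is $c:K\times S\times A\times B\to[0,\infty)$, and $\alpha>0$ is a fixed discount factor. $G(p)$ denotes the game with type distribution $p\in\mathcal P(K)$. Policies. $\mathcal H_n=(S\times A\times B)^n\times S$ is the set of histories $h_n=(i_0,a_0,b_0,\dots,a_{n-1},b_{n-1},i_n)$. $\Pi$ is the set of policies of Player 1, i.e. families $\pi=\{\pi_n^{(k)}:k\in K,n\ge0\}$ of stochastic kernels $\pi_n^{(k)}(\cdot|h_n)\in\mathcal P(A)$, $h_n\in\mathcal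 H_n$. $\Sigma$ is the set of policies of Player 2, i.e. families $\sigma=\{\sigma_n:n\ge0\}$ of stochastic kernels $\sigma_n(\cdot|h_n)\in\mathcal P(B)$ (not depending on $k$). Probability. On $\Omega=K\times(S\times A\times B\times[0,\infty))^\infty$ with product $\sigma$-algebra, for $\omega=(k,i_0,a_0,b_0,t_1,i_1,a_1,b_1,t_2,\dots)$ put $\kappa=k$, $X_n=i_n$, $A_n=a_n$, $B_n=b_n$, $T_0=0$, $T_{n}=\sum_{m=1}^{n}t_m$, $H_n=(X_0,A_0,B_0,\dots,A_{n-1},B_{n-1},X_n)$, $T_\infty=\lim_nT_n$. For $p\in\mathcal P(K)$, $i\in S$, $\pi\in\Pi$, $\sigma\in\Sigma$, $\mathbb P_{p,i}^{\pi,\sigma}$ (expectation $\mathbb E_{p,i}^{\pi,\sigma}$) is the unique probability measure with $\mathbb P(X_0=i,\kappa=k)=p_k$; $\mathbb P(A_n=a,B_n=b|\kappa,H_n,T_n)=\pi_n^{(\kappa)}(a|H_n)\sigma_n(b|H_n)$; $\mathbb P(T_{n+1}-T_n\le t,X_{n+1}=j|\kappa,H_n,T_n,A_n,B_n)=Q(t,j|X_n,A_n,B_n)$. Payoff and value. For $t\in[T_n,T_{n+1})$ the continuous-time processes (written with subscript $t$) take the values $X_n,A_n,B_n$. $V(p,i,\pi,\sigma)=\mathbb E_{p,i}^{\pi,\sigma}\big[\int_0^{T_\infty}e^{-\alpha t}c(\kappa,X_t,A_t,B_t)\,dt\big]$; $\underline V(p,i)=\sup_{\pi\in\Pi}\inf_{\sigma\in\Sigma}V(p,i,\pi,\sigma)$,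 $\overline V(p,i)=\inf_{\sigma\in\Sigma}\sup_{\pi\in\Pi}V(p,i,\pi,\sigma)$. Under the hypothesis of the claim these coincide for all $(p,i)$ and the common value is $V^*(p,i)$. A policy $\sigma^*\in\Sigma$ is optimal for Player 2 in $G(p)$ if $\sup_{\pi\in\Pi}V(p,i,\pi,\sigma^* )\le\overline V(p,i)$ for all $i\in S$. *)

(* Defs.v *)
From HB Require Import structures.
From mathcomp Require Import all_boot all_order all_algebra.
From mathcomp Require Import all_classical all_reals all_analysis.

Set Implicit Arguments.
Unset Strict Implicit.
Unset Printing Implicit Defensive.

Import Order.TTheory GRing.Theory Num.Theory.
Import numFieldNormedType.Exports.

Local Open Scope classical_set_scope.
Local Open Scope ring_scope.

(* Finite nonempty sets: the point is needed because measurable types are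
   pointed types in MathComp-Analysis. *)
#[short(type="finPointedType")]
HB.structure Definition FinPointed := {T of Finite T & Pointed T}.

Record fdist (R : realType) (E : finType) := FDist {
  fdist_val :> E -> R;
  fdist_ge0 : forall x, 0 <= fdist_val x;
  fdist_sum1 : \sum_x fdist_val x = 1 }.

(* [Q t j i a b] is Q(t,j|i,a,b); its values at t < 0 are irrelevant. *)
Record semi_markov_kernel (R : realType) (S A B : finType)
    (Q : R -> S -> S -> A -> B -> R) : Prop := SemiMarkovKernel {
  smk_ge0 : forall t j i a b, 0 <= t -> 0 <= Q t j i a b;
  smk_homo : forall j i a b s t, 0 <= s -> s <= t -> Q s j i a b <= Q t j i a b;
  smk_rcont : forall j i a b t, 0 <= t ->
    Q s j i a b @[s --> t^'+] --> Q t j i a b;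
  smk_0 : forall j i a b, Q 0 j i a b = 0;
  smk_le1 : forall i a b t, 0 <= t -> \sum_j Q t j i a b <= 1;
  smk_lim : forall i a b, \sum_j lim (Q t j i a b @[t --> +oo]) = 1 }.

Definition sojourn_cdf (R : realType) (S A B : finType)
    (Q : R -> S -> S -> A -> B -> R) (t : R) (i : S) (a : A) (b : B) : R :=
  \sum_j Q t j i a b.

Definition history (S A B : finType) (n : nat) : Type :=
  (n.-tuple (S * A * B) * S)%type.

Definition policy1 (R : realType) (K S A B : finType) : Type :=
  K -> forall n, history S A B n -> fdist R A.

Definition policy2 (R : realType) (S A B : finType) : Type :=
  forall n, history S A B n -> fdist R B.

(* [(k, f)] with [f n = (i_n, a_n, b_n, t_{n+1})]. *)
Definition sample (R : realType) (K S A B : finPointedType) : Type :=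
  (K * (nat -> S * A * B * {nonneg R}))%type.

HB.instance Definition _ (R : realType) (K S A B : finPointedType) :=
  Choice.copy (sample R K S A B)
    (K * (nat -> S * A * B * {nonneg R}))%type.
HB.instance Definition _ (R : realType) (K S A B : finPointedType) :=
  isPointed.Build (sample R K S A B) (point, fun=> (point, 0%:nng)).

Section coordinates.
Context (R : realType) (K S A B : finPointedType).
Implicit Types (w : sample R K S A B) (n : nat).

Definition kappa w : K := w.1.
Definition state n w : S := (w.2 n).1.1.1.
Definition act1 n w : A := (w.2 n).1.1.2.
Definition act2 n w : B := (w.2 n).1.2.
Definition sojourn n w : R := (w.2 n).2%:num.
Definition jump_time n w : R := \sum_(m < n) sojourn m w.
Definition explosion_time w : \bar R := limn (fun n => (jump_time n w)%:E).
Definition hist n w : history S A B n :=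
  ([tuple (state m w, act1 m w, act2 m w) | m < n], state n w).

(* Generators of the product sigma-algebra, the finite factors being discrete
   and [0, +oo[ carrying its Borel sets. *)
Definition cylinders : set (set (sample R K S A B)) :=
  [set C | (exists k, C = [set w | kappa w = k]) \/
           (exists n i, C = [set w | state n w = i]) \/
           (exists n a, C = [set w | act1 n w = a]) \/
           (exists n b, C = [set w | act2 n w = b]) \/
           (exists n (Y : set R), measurable Y /\ C = sojourn n @^-1` Y)].

End coordinates.

Definition Omega (R : realType) (K S A B : finPointedType) :=
  g_sigma_algebraType (@cylinders R K S A B).

(* [f] is a version of the conditional probability of the event [E] given the
   sub-sigma-algebra [F]. *)
Definition cond_prob (R : realType) d (U : measurableType d)
    (P : probability U R) (F : set (set U)) (E : set U) (f : U -> R) : Prop :=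
  (forall Y : set R, measurable Y -> F (f @^-1` Y)) /\
  (forall G, F G -> P (E `&` G) = (\int[P]_(w in G) (f w)%:E)%E).

Section game.
Context (R : realType) (K S A B : finPointedType).
Local Notation Omega := (Omega R K S A B).
Local Notation policy1 := (policy1 R K S A B).
Local Notation policy2 := (policy2 R S A B).

(* sigma(kappa, H_n, T_n) *)
Definition sigma_state (n : nat) : set (set Omega) :=
  <<s [set G | exists k h (Y : set R), measurable Y /\
    G = [set w | [/\ kappa w = k, hist n w = h & Y (jump_time n w)]]] >>.

(* sigma(kappa, H_n, T_n, A_n, B_n) *)
Definition sigma_action (n : nat) : set (set Omega) :=
  <<s [set G | exists k h (Y : set R) a b, measurable Y /\
    G = [set w | [/\ kappa w = k, hist n w = h, Y (jump_time n w),
                     act1 n w = a & act2 n w = b]]] >>.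

Record game_law (Q : R -> S -> S -> A -> B -> R) (p : fdist R K) (i : S)
    (pi : policy1) (sigma : policy2) (P : probability Omega R) : Prop :=
  GameLaw {
  law_init : forall k, P [set w | state 0 w = i /\ kappa w = k] = (p k)%:E;
  law_action : forall n a b,
    cond_prob P (sigma_state n)
      [set w | act1 n w = a /\ act2 n w = b]
      (fun w => pi (kappa w) n (hist n w) a * sigma n (hist n w) b);
  law_jump : forall n t j, 0 <= t ->
    cond_prob P (sigma_action n)
      [set w | jump_time n.+1 w - jump_time n w <= t /\ state n.+1 w = j]
      (fun w => Q t j (state n w) (act1 n w) (act2 n w)) }.

(* The n with T_n <= t < T_{n+1}, which exists and is unique for
   0 <= t < T_infty. *)
Definition jump_index (w : Omega) (t : R) : nat :=
  xget 0%N [set n | jump_time n w <= t < jump_time n.+1 w].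

Definition discounted_payoff (c : K -> S -> A -> B -> R) (alpha : R)
    (w : Omega) : \bar R :=
  (\int[lebesgue_measure]_(t in [set t : R | (0 <= t)%R /\ t%:E < explosion_time w])
     (let n := jump_index w t in
      expR (- (alpha * t)) * c (kappa w) (state n w) (act1 n w) (act2 n w))%:E)%E.

Definition payoff_function : Type :=
  fdist R K -> S -> policy1 -> policy2 -> \bar R.

Definition expected_payoff (c : K -> S -> A -> B -> R) (alpha : R)
    (P : fdist R K -> S -> policy1 -> policy2 -> probability Omega R) :
    payoff_function :=
  fun p i pi sigma =>
    (\int[P p i pi sigma]_w discounted_payoff c alpha w)%E.

Definition lower_value (V : payoff_function) (p : fdist R K) (i : S) : \bar R :=
  ereal_sup [set ereal_inf [set V p i pi sigma | sigma in [set: policy2]]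
            | pi in [set: policy1]].

Definition upper_value (V : payoff_function) (p : fdist R K) (i : S) : \bar R :=
  ereal_inf [set ereal_sup [set V p i pi sigma | pi in [set: policy1]]
            | sigma in [set: policy2]].

Definition is_value (V : payoff_function) (Vstar : fdist R K -> S -> \bar R) :
    Prop :=
  forall p i, lower_value V p i = Vstar p i /\ upper_value V p i = Vstar p i.

Definition optimal2 (V : payoff_function) (p : fdist R K) (sigma : policy2) :
    Prop :=
  forall i, (ereal_sup [set V p i pi sigma | pi in [set: policy1]]
             <= upper_value V p i)%E.

End game.

(* Main.v *)
(* The payoff of a pair of policies is a series of expected stage payoffs
   E[c(kappa,X_n,A_n,B_n) (exp(-alpha T_n) - exp(-alpha T_(n+1))) / alpha].
   Writing exp(-alpha x) as the integral of alpha exp(-alpha s) over s >= x turns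
   the defining conditional probabilities into a recursion for
   E[exp(-alpha T_n); kappa = k, H_n = h], so that each stage payoff is a finite
   sum, polynomial in the action probabilities chosen by Player 2.  The stage
   payoffs are nonnegative, hence sigma |-> sup_pi V(p,i,pi,sigma) is a supremum
   of continuous functions, i.e. lower semicontinuous, on the set of policies of
   Player 2, which is compact by Tychonoff's theorem: the infimum is attained for
   every initial state i.  As V(p,i,pi,sigma) only involves sigma at histories
   starting in i, the minimizers for the various i glue into one policy. *)

Require Import Defs.
From mathcomp Require Import all_boot all_order all_algebra.
From mathcomp Require Import all_classical all_reals all_analysis.
From mathcomp Require Import measurable_realfun.
From mathcomp Require Import ring.

Set Implicit Arguments.
Unset Strict Implicit.
Unset Printing Implicit Defensive.

Import Order.TTheory GRing.Theory Num.Theory.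
Import numFieldNormedType.Exports.

Local Open Scope classical_set_scope.
Local Open Scope ring_scope.

(** * Integrals of the discount factor over half-lines and intervals *)

Section exponential_integrals.
Context (R : realType) (alpha : R).
Hypothesis alpha_gt0 : 0 < alpha.
Local Notation mu := (@lebesgue_measure R).

Let continuous_exp (a : R) : continuous (fun x : R => expR (- (a * x))).
Proof.
move=> x; apply: continuous_comp; last exact: continuous_expR.
apply: (@continuousN _ R^o); apply: continuousM => //; exact: cst_continuous.
Qed.

Let continuous_scaled_exp :
  continuous (fun x : R => alpha * expR (- (alpha * x))).
Proof.
move=> x; apply: cvgM; [exact: cvg_cst|exact: continuous_exp].
Qed.

Lemma measurable_expRNM (a : R) :
  measurable_fun setT (fun x : R => expR (- (a * x))).
Proof. by apply: continuous_measurable_fun; exact: continuous_exp. Qed.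

Lemma integral_exp_tail (x : R) :
  (\int[mu]_(t in `[x, +oo[) (alpha * expR (- (alpha * t)))%:E =
   (expR (- (alpha * x)))%:E)%E.
Proof.
rewrite (@ge0_continuous_FTC2y _ _ (fun t => - (expR (- (alpha * t)))) _ 0)//.
- by rewrite EFinN oppeK add0e.
- by move=> t _; rewrite mulr_ge0 ?expR_ge0 ?ltW.
- by apply: continuous_subspaceT; exact: continuous_scaled_exp.
- rewrite -oppr0; apply: cvgN.
  rewrite (_ : (fun x => expR (- (alpha * x))) =
               (fun z => expR (- z)) \o (fun z => alpha * z))//.
  apply: (@cvg_comp _ _ _ _ _ _ (pinfty_nbhs R)); last exact: cvgr_expR.
  exact: gt0_cvgMry.
- by apply: cvgN; apply/cvg_at_right_filter; exact: continuous_exp.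
- move=> z _.
  rewrite derive1_comp// derive1N// derive1_id mulN1r derive1_comp// derive1E.
  have /funeqP -> := @derive_expR R.
  by rewrite derive1N// derive1Ml// derive1_id mulr1 mulrN opprK mulrC.
Qed.

Lemma integral_exp_itv (x y : R) : x <= y ->
  (\int[mu]_(t in `[x, y[) (expR (- (alpha * t)))%:E =
   ((expR (- (alpha * x)) - expR (- (alpha * y))) / alpha)%:E)%E.
Proof.
move=> xy.
have me D : measurable_fun D (fun t : R => (alpha * expR (- (alpha * t)))%:E).
  apply/measurable_EFinP; apply: measurable_funM => //.
  exact: (measurable_funS measurableT _ (@measurable_expRNM alpha)).
have e0 t : (0 <= (alpha * expR (- (alpha * t)))%:E)%E.
  by rewrite lee_fin mulr_ge0 ?expR_ge0 ?ltW.
have := integral_exp_tail x.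
have -> : `[x, +oo[%classic = `[x, y[%classic `|` `[y, +oo[%classic :> set R.
  by rewrite -itv_bndbnd_setU// bnd_simp.
rewrite ge0_integral_setU//=; first last.
  apply/disj_setPRL => t/=; rewrite !in_itv/= andbT => yt.
  by apply/negP; rewrite negb_and -!leNgt yt orbT.
  exact: me.
rewrite integral_exp_tail.
under eq_integral do rewrite EFinM.
rewrite ge0_integralZl//=; last 2 first.
- apply/measurable_EFinP.
  exact: (measurable_funS measurableT _ (@measurable_expRNM alpha)).
- by rewrite lee_fin ltW.
have := @integral_ge0 _ _ _ mu `[x, y[ (fun t => (expR (- (alpha * t)))%:E).
move=> /(_ (fun t _ => expR_ge0 _)).
(* The integral is an extended real so far: nonnegativity excludes [-oo], and [+oo] would contradict
   the finite tail from [x]. *)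
case: (integral _ _ _) => [r|_|//]; last by rewrite gt0_muley// lte_fin.
move=> _ /= [] <-; congr EFin; rewrite addrK mulrC mulKf//.
by rewrite gt_eqF.
Qed.

End exponential_integrals.

(** * Laplace transforms by the layer-cake formula *)

Section layer_cake.
Context d (T : measurableType d) (R : realType) (P : probability T R).
Context (alpha : R) (alpha_gt0 : 0 < alpha).
Implicit Types (E : set T) (X Y Z : T -> R).
Local Notation mu := (@lebesgue_measure R).

Lemma measurable_sublevel X s : measurable_fun setT X ->
  measurable [set w | X w <= s].
Proof.
move=> mX; rewrite -[X in measurable X]setTI.
have := measurable_fun_ler mX (measurable_cst s) => /(_ measurableT [set true]).
by apply.
Qed.

(** Integrand on the product of [T] with the [s]-axis. Integrating out [s] gives [Z * exp(-alpha X)]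
    on [E]; integrating out [w] gives the [Z]-mass of [E] below level [s] of [X], times the
    exponential density. *)
Let layer E X Z (ws : T * R) : \bar R :=
  (Z ws.1 * \1_E ws.1 *
    (alpha * expR (- (alpha * ws.2)) * (X ws.1 <= ws.2)%R%:R))%:E.

Let measurable_layer_pair E X Z : measurable E -> measurable_fun setT X ->
  measurable_fun setT Z -> measurable_fun setT (layer E X Z).
Proof.
move=> mE mX mZ; apply/measurable_EFinP; apply: measurable_funM.
  apply: measurable_funM; first exact: measurableT_comp.
  apply: measurableT_comp => //; exact: measurable_indic.
apply: measurable_funM.
  apply: measurable_funM => //.
  exact: (measurableT_comp (measurable_expRNM alpha)).
rewrite (_ : (fun x : T * R => _) =
  (fun b : bool => b%:R : R) \o (fun x : T * R => X x.1 <= x.2)%R)//.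
apply: measurableT_comp => //.
apply: (measurable_fun_ler (f := X \o fst) (g := snd)) => //.
exact: measurableT_comp.
Qed.

Let layer_ge0 E X Z ws : (forall w, 0 <= Z w) -> (0 <= layer E X Z ws)%E.
Proof.
move=> Z0; rewrite lee_fin; apply: mulr_ge0; first exact: mulr_ge0.
by rewrite mulr_ge0// mulr_ge0 ?expR_ge0// ltW.
Qed.

Let layerE E X Z s : measurable E -> measurable_fun setT X ->
  measurable_fun setT Z -> (forall w, 0 <= Z w) ->
  (\int[P]_w layer E X Z (w, s) = (alpha * expR (- (alpha * s)))%:E *
    \int[P]_(w in E `&` [set w | X w <= s]%R) (Z w)%:E)%E.
Proof.
move=> mE mX mZ Z0.
have mXs := measurable_sublevel s mX.
rewrite [in RHS]integral_mkcond -ge0_integralZl//=; last 3 first.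
- apply/(measurable_restrictT _ _).1; first exact: measurableI.
  by apply/measurable_EFinP; exact: measurable_funS mZ.
- by move=> w _; rewrite /patch; case: ifP => // _; rewrite lee_fin.
- by rewrite lee_fin mulr_ge0 ?expR_ge0// ltW.
apply: eq_integral => w _; rewrite /layer /= patchE in_setI indicE.
have -> : (w \in [set w | X w <= s]%R) = (X w <= s).
  by apply/idP/idP; rewrite inE.
case: (w \in E) => /=; last by rewrite mulr0 mul0r mule0.
by case: ifP => _ /=; rewrite ?mulr1 ?mulr0 ?mule0// mulrC.
Qed.

Lemma measurable_layer E X Z : measurable E -> measurable_fun setT X ->
  measurable_fun setT Z -> (forall w, 0 <= Z w) ->
  measurable_fun setT (fun s : R => (alpha * expR (- (alpha * s)))%:E *
    \int[P]_(w in E `&` [set w | X w <= s]%R) (Z w)%:E)%E.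
Proof.
move=> mE mX mZ Z0; under eq_fun do rewrite -layerE//.
apply: (measurable_fun_fubini_tonelli_G (m1 := P) (layer E X Z)).
- exact: measurable_layer_pair.
- by move=> ?; exact: layer_ge0.
Qed.

(** Tonelli: the two sides are the iterated integrals of [layer] in the two orders. *)
Lemma layer_cake_exp E X Z : measurable E -> measurable_fun setT X ->
  measurable_fun setT Z -> (forall w, 0 <= Z w) ->
  (\int[P]_(w in E) (Z w * expR (- (alpha * X w)))%:E =
   \int[mu]_s ((alpha * expR (- (alpha * s)))%:E *
    \int[P]_(w in E `&` [set w | X w <= s]%R) (Z w)%:E))%E.
Proof.
move=> mE mX mZ Z0; under [RHS]eq_integral do rewrite -layerE//.
transitivity (\int[P]_w \int[mu]_s layer E X Z (w, s))%E; last first.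
  apply: (@fubini_tonelli _ _ T (measurableTypeR R) R P (@lebesgue_measure R) (layer E X Z)).
  - exact: measurable_layer_pair.
  - by move=> ?; exact: layer_ge0.
rewrite integral_mkcond; apply: eq_integral => w _.
(* For fixed [w] the condition [X w <= t] cuts the exponential density down to its tail from
   [X w]. *)
transitivity ((Z w * \1_E w)%:E * \int[mu]_t
    ((fun t => (alpha * expR (- (alpha * t)))%:E) \_ `[X w, +oo[) t)%E.
  rewrite -integral_mkcond (integral_exp_tail alpha_gt0) -EFinM patchE indicE.
  by case: (w \in E); rewrite ?mulr1// mulr0 mul0r.
rewrite -ge0_integralZl//=; last 3 first.
- apply/(measurable_restrictT _ _).1 => //; apply/measurable_EFinP.
  apply: measurable_funM => //.
  exact: (measurable_funS measurableT _ (@measurable_expRNM _ alpha)).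
- move=> t _; rewrite patchE; case: ifP => // _.
  by rewrite lee_fin mulr_ge0 ?expR_ge0// ltW.
- by rewrite lee_fin mulr_ge0.
apply: eq_integral => t _; rewrite patchE /layer /=.
have -> : (t \in `[X w, +oo[%classic) = (X w <= t).
  by rewrite mem_setE in_itv/= andbT.
by case: ifP => _; rewrite ?mulr1 ?mulr0 ?mule0.
Qed.

(** By the layer-cake formula with [Z = 1], the Laplace transform of [X] on an event is a linear
    function of [s |-> P(E, X <= s)]. *)
Lemma laplace_proportional E1 E2 X (r : R) :
  measurable E1 -> measurable E2 -> measurable_fun setT X -> 0 <= r ->
  (forall s, P (E1 `&` [set w | X w <= s]%R) =
             (r%:E * P (E2 `&` [set w | X w <= s]%R))%E) ->
  (\int[P]_(w in E1) (expR (- (alpha * X w)))%:E =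
   r%:E * \int[P]_(w in E2) (expR (- (alpha * X w)))%:E)%E.
Proof.
move=> mE1 mE2 mX r0 HE.
have mXs s := measurable_sublevel s mX.
have integral1 E : measurable E -> (\int[P]_(w in E) (1 : R)%:E = P E)%E.
  by move=> mE; rewrite (eq_integral (cst 1%E))// integral_cst// mul1e.
have LC E : measurable E ->
  (\int[P]_(w in E) (expR (- (alpha * X w)))%:E = \int[mu]_s
    ((alpha * expR (- (alpha * s)))%:E * P (E `&` [set w | X w <= s]%R)))%E.
  move=> mE; under eq_integral do rewrite -[expR _]mul1r.
  rewrite (layer_cake_exp mE mX (measurable_cst (1 : R)) (fun=> ler01)).
  apply: eq_integral => s _.
  by congr (_ * _)%E; apply: integral1; exact: measurableI.
rewrite !LC// -ge0_integralZl//=.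
- by apply: eq_integral => s _; rewrite HE muleCA.
- have := measurable_layer mE2 mX (measurable_cst (1 : R)) (fun=> ler01).
  apply: eq_measurable_fun => s _.
  by congr (_ * _)%E; apply: integral1; exact: measurableI.
- by move=> s _; rewrite mule_ge0// lee_fin mulr_ge0 ?expR_ge0// ltW.
Qed.

(** The layer-cake formula is applied in [Y] with weight [exp(-alpha X)]; at each level [t] the
    inner integral is handled by [laplace_proportional] with ratio [H t]. It serves with [X] a jump
    time and [Y] the sojourn that follows. *)
Lemma laplace_independent E1 E2 X Y (H : R -> R) :
  measurable E1 -> measurable E2 ->
  measurable_fun setT X -> measurable_fun setT Y ->
  {homo H : s t / s <= t} -> (forall t, 0 <= H t) ->
  (forall s t, P (E1 `&` [set w | Y w <= t]%R `&` [set w | X w <= s]%R) =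
               ((H t)%:E * P (E2 `&` [set w | X w <= s]%R))%E) ->
  (\int[P]_(w in E1) (expR (- (alpha * X w)) * expR (- (alpha * Y w)))%:E =
   (\int[mu]_t (alpha * expR (- (alpha * t)) * H t)%:E) *
   \int[P]_(w in E2) (expR (- (alpha * X w)))%:E)%E.
Proof.
move=> mE1 mE2 mX mY H_homo H0 HE.
have mYt t := measurable_sublevel t mY.
rewrite layer_cake_exp//; last first.
  exact: (measurableT_comp (measurable_expRNM alpha)).
rewrite muleC -ge0_integralZl//=.
  - apply: eq_integral => t _.
    rewrite (@laplace_proportional _ E2 X (H t))//; last exact: measurableI.
    by rewrite [in RHS]muleC EFinM muleA.
  - apply/measurable_EFinP; apply: measurable_funM.
      by apply: measurable_funM => //; exact: measurable_expRNM.
    exact: nondecreasing_measurable.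
  - by move=> t _; rewrite lee_fin !mulr_ge0 ?expR_ge0// ltW.
  - by apply: integral_ge0 => w _; rewrite lee_fin expR_ge0.
Qed.

End layer_cake.

(** * Compactness of the policies of Player 2 *)

Lemma continuous_sum (R : realType) (T : topologicalType) (I : Type)
    (r : seq I) (F : I -> T -> R) :
  (forall i, continuous (F i)) -> continuous (fun x => \sum_(i <- r) F i x).
Proof.
move=> Fc; apply: (@continuous_big R I +%R 0 xpredT) => //.
exact: add_continuous.
Qed.

Lemma continuous_mul (R : realType) (T : topologicalType) (f g : T -> R) :
  continuous f -> continuous g -> continuous (fun x => f x * g x).
Proof. by move=> fc gc x; apply: cvgM; [exact: fc|exact: gc]. Qed.

(** A supremum of continuous functions is lower semicontinuous, so it attains its infimum on a
    compact set. Suprema are taken in the extended reals, as the family may be unbounded. *)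
Lemma compact_min_sup (R : realType) (T : topologicalType) (I : Type)
    (K : set T) (g : I -> T -> R) :
  compact K -> K !=set0 -> (forall i, continuous (g i)) ->
  exists2 x, K x & forall y, K y ->
    (ereal_sup [set (g i x)%:E | i in [set: I]] <=
     ereal_sup [set (g i y)%:E | i in [set: I]])%E.
Proof.
move=> Kc [x0 Kx0] gc.
pose F x := ereal_sup [set (g i x)%:E | i in [set: I]].
pose m := ereal_inf [set F y | y in K].
suff [x Kx xm] : exists2 x, K x & forall i, m != +oo%E -> ((g i x)%:E <= m)%E.
  exists x => // y Ky.
  have my : (m <= F y)%E by apply: ereal_inf_lbound; exists y.
  apply: ge_ereal_sup => _ [i _ <-].
  have [moo|moo] := eqVneq m +oo%E; last exact: (le_trans (xm i moo)).
  by move: my; rewrite moo leye_eq => /eqP; rewrite /F => ->; rewrite leey.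
have [moo|moo] := eqVneq m +oo%E; first by exists x0.
(* A cluster point of the sublevel sets above the infimum is a minimizer. *)
pose U r := K `&` [set y | (F y <= r)%E].
pose FF := filter_from [set r | (m < r)%E] U.
have FFP : ProperFilter FF.
  apply: filter_from_proper.
    apply: filter_from_filter; first by exists +oo%E; rewrite /= ltey.
    move=> r s /= mr ms; exists (Order.min r s); first by rewrite /= lt_min mr.
    by move=> y [Ky /=]; rewrite le_min => /andP[yr ys].
  move=> r /= /ereal_inf_lt[_ [y Ky <-] yr].
  by exists y; split => //; exact: ltW.
have FFK : FF K by exists +oo%E; rewrite /= ?ltey// => y [].
have [x [Kx clx]] := Kc _ FFP FFK.
exists x => // i _; rewrite leNgt; apply/negP => mgx.
(* A real level separating [m] from [g i x]: their midpoint, or [g i x - 1] when [m] is [-oo].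
   Points near [x] lie above it, yet [x] clusters the sublevel set [U e]. *)
have [e me ex] : exists2 e : R, (m < e%:E)%E & e < g i x.
  move: (m) mgx moo => [r| |]//.
    rewrite lte_fin => rg _; exists ((r + g i x) / 2); last by rewrite midf_lt.
    by rewrite lte_fin midf_lt.
  by move=> _ _; exists (g i x - 1); rewrite ?ltNye// ltrBlDr ltrDl.
have nx : nbhs x [set y | e < g i y].
  by apply: (gc i x [set z | e < z]); exact: lt_nbhsr ex.
have [y [[Ky /= Fy] /= ey]] := clx (U e%:E) _ (ex_intro2 _ _ e%:E me (fun=> id)) nx.
have : ((g i y)%:E <= e%:E)%E.
  by apply: le_trans Fy; apply: ereal_sup_ubound; exists i.
by rewrite lee_fin leNgt ey.
Qed.

Section policies.
Context (R : realType) (S A B : finPointedType).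

(* Behaviour of Player 2 with arbitrary real weights, so that payoffs become
   polynomials on a full product space. *)
Definition kernel2 := forall n, history S A B n -> B -> R.

Definition kernel2_of_policy (sigma : policy2 R S A B) : kernel2 :=
  fun n h b => sigma n h b.

(* [history] is spelled out so that its eqType structure is found. *)
Definition choice_point := {n : nat & (n.-tuple (S * A * B) * S * B)%type}.

Definition kernel2_of_coord (f : choice_point -> R) : kernel2 :=
  fun n h b => f (existT _ n (h, b)).

Lemma continuous_kernel2_of_coord n (h : history S A B n) b :
  continuous (fun f : prod_topology (fun _ : choice_point => R^o) =>
                kernel2_of_coord f h b : R).
Proof.
exact: (@proj_continuous choice_point (fun=> R^o) (existT _ n (h, b))).
Qed.

(** Policies are the points of the cube [[0, 1]^choice_point] satisfying one closed condition per
    history, total mass 1. The cube is compact by Tychonoff, hence so is this subset. *)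
Lemma policy2_min_sup (I : Type) (W : I -> kernel2 -> R) :
  (forall i, continuous (fun f : prod_topology (fun _ : choice_point => R^o) =>
                           W i (kernel2_of_coord f))) ->
  exists sigma : policy2 R S A B, forall sigma' : policy2 R S A B,
    (ereal_sup [set (W i (kernel2_of_policy sigma))%:E | i in [set: I]] <=
     ereal_sup [set (W i (kernel2_of_policy sigma'))%:E | i in [set: I]])%E.
Proof.
move=> Wc.
pose X := prod_topology (fun _ : choice_point => R^o).
pose cube := [set f : X | forall j, `[0, 1]%classic (f j)].
pose simplex := [set f : X | forall (n : nat) (h : history S A B n),
  \sum_b kernel2_of_coord f h b = 1].
have pol_of (f : X) : cube f -> simplex f ->
    exists sigma, kernel2_of_policy sigma = kernel2_of_coord f.
  move=> cf sf.
  have f0 n (h : history S A B n) b : 0 <= kernel2_of_coord f h b.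
    by have := cf (existT _ n (h, b)); rewrite /= in_itv/= => /andP[].
  by exists (fun n h => FDist (f0 n h) (sf n h)).
pose coord (sigma : policy2 R S A B) : X :=
  fun j => sigma (tag j) (tagged j).1 (tagged j).2.
have coordP sigma : (cube `&` simplex) (coord sigma).
  split=> [[n [h b]]|n h]; last by rewrite -[RHS](fdist_sum1 (sigma n h)).
  rewrite /= in_itv/= /coord /= fdist_ge0/=.
  rewrite -(fdist_sum1 (sigma n h)) (bigD1 b)//= lerDl.
  by apply: sumr_ge0 => *; exact: fdist_ge0.
have cubec : compact cube.
  apply: (@tychonoff choice_point (fun=> R^o) (fun=> `[0, 1]%classic)) => j.
  exact: segment_compact.
have sc : closed simplex.
  rewrite (_ : simplex = \bigcap_n \bigcap_(h in [set: history S A B n])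
      ((fun f : X => \sum_b kernel2_of_coord f h b) @^-1` [set 1])); last first.
    by apply/seteqP; split=> f /= H n => [_ h _|h]; apply: H.
  apply: closed_bigI => n _; apply: closed_bigI => h _.
  apply: preimage_closed.
    move=> f _; apply: continuous_sum => b.
    exact: continuous_kernel2_of_coord.
  exact: closed_eq.
have Kc : compact (cube `&` simplex).
  exact: compact_closedI.
(* A witness of nonemptiness: the policy that always plays [point]. *)
have unif : exists sigma : policy2 R S A B, True.
  have d0 b : 0 <= (b == point :> B)%:R :> R by [].
  have d1 : \sum_b (b == point :> B)%:R = 1 :> R.
    by rewrite (bigD1 point)//= eqxx big1 ?addr0// => b /negPf ->.
  by exists (fun _ _ => FDist d0 d1).
have [sigma0 _] := unif.
have [f [cf sf] fmin] := compact_min_sup Kc (ex_intro _ _ (coordP sigma0)) Wc.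
have [sigma sigmaE] := pol_of f cf sf.
exists sigma => sigma'.
by rewrite sigmaE; exact: (fmin _ (coordP sigma')).
Qed.

End policies.

(** * Measurability of the coordinates *)

Section finite_partition.
Context d (T : measurableType d) (R : realType).

Lemma measurable_fun_finite_partition d' (T' : measurableType d') (J : finType)
    (X : T -> J) (f : T -> T') :
  (forall j, measurable [set w | X w = j]) ->
  (forall j, measurable_fun [set w | X w = j] f) -> measurable_fun setT f.
Proof.
move=> mX mf _ Y mY; rewrite (_ : _ `&` _ =
    \bigcup_(j in [set: J]) ([set w | X w = j] `&` f @^-1` Y)); last first.
  apply/seteqP; split=> w /=; first by move=> [_ fY]; exists (X w).
  by move=> [j _ [_ ?]].
by apply: fin_bigcup_measurable => // j _; exact: mf.
Qed.

Variable mu : {measure set T -> \bar R}.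

Lemma ge0_integral_finite_partition (J : finType) (X : T -> J) (D : set T)
    (f : T -> \bar R) :
  measurable D -> (forall j, measurable [set w | X w = j]) ->
  measurable_fun D f -> (forall w, D w -> 0 <= f w)%E ->
  (\int[mu]_(w in D) f w =
   \sum_j \int[mu]_(w in D `&` [set w | X w = j]) f w)%E.
Proof.
move=> mD mX mf f0.
under [RHS]eq_bigr do rewrite integral_mkcondr.
rewrite -ge0_integral_sum//.
- apply: eq_integral => w _; rewrite (bigD1 (X w))//= big1 ?adde0.
    by rewrite patchE mem_set.
  by move=> j jX; rewrite patchE memNset//= => Xj; rewrite Xj eqxx in jX.
- move=> j; apply/(measurable_restrict _ _ _).1 => //.
  by apply: measurable_funS mf => // w [].
- by move=> j w Dw; rewrite patchE; case: ifP => // _; exact: f0.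
Qed.

End finite_partition.

Section coordinate_measurability.
Context (R : realType) (K S A B : finPointedType).
Local Notation Omega := (Omega R K S A B).

Lemma measurable_kappa k : measurable ([set w | kappa w = k] : set Omega).
Proof. by apply: sub_gen_smallest; left; exists k. Qed.

Lemma measurable_state n i : measurable ([set w | state n w = i] : set Omega).
Proof. by apply: sub_gen_smallest; right; left; exists n, i. Qed.

Lemma measurable_act1 n a : measurable ([set w | act1 n w = a] : set Omega).
Proof. by apply: sub_gen_smallest; do 2 right; left; exists n, a. Qed.

Lemma measurable_act2 n b : measurable ([set w | act2 n w = b] : set Omega).
Proof. by apply: sub_gen_smallest; do 3 right; left; exists n, b. Qed.

Lemma measurable_sojourn n :
  measurable_fun setT (@sojourn R K S A B n : Omega -> R).
Proof.
move=> _ Y mY; rewrite setTI; apply: sub_gen_smallest.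
by do 4 right; exists n, Y.
Qed.

Lemma measurable_jump_time n :
  measurable_fun setT (@jump_time R K S A B n : Omega -> R).
Proof.
by apply: measurable_sum => m; exact: measurable_sojourn.
Qed.

Lemma jump_time0 (w : Omega) : jump_time 0 w = 0.
Proof. by rewrite /jump_time big_ord0. Qed.

Lemma jump_timeS n (w : Omega) : jump_time n.+1 w = jump_time n w + sojourn n w.
Proof. by rewrite /jump_time big_ord_recr. Qed.

Lemma sojourn_ge0 n (w : Omega) : 0 <= sojourn n w.
Proof. by rewrite /sojourn. Qed.

Lemma jump_time_homo (w : Omega) :
  {homo (fun n => jump_time n w) : m n / (m <= n)%N >-> m <= n}.
Proof.
apply: homo_leq => // [x y z|n]; first exact: le_trans.
by rewrite jump_timeS lerDl sojourn_ge0.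
Qed.

Lemma jump_time_ge0 n (w : Omega) : 0 <= jump_time n w.
Proof. by rewrite -(jump_time0 w) jump_time_homo. Qed.

(** The current state of the shortened history is the one recorded in the last triple of [h]; [h.2],
    the state reached at step [n.+1], is dropped. *)
Definition hist_init n (h : history S A B n.+1) : history S A B n :=
  ([tuple tnth h.1 (widen_ord (leqnSn n) m) | m < n], (tnth h.1 ord_max).1.1).

Definition hist_act1 n (h : history S A B n.+1) : A := (tnth h.1 ord_max).1.2.

Definition hist_act2 n (h : history S A B n.+1) : B := (tnth h.1 ord_max).2.

Lemma hist_succP n (w : Omega) (h : history S A B n.+1) :
  hist n.+1 w = h <->
  [/\ hist n w = hist_init h, act1 n w = hist_act1 h,
      act2 n w = hist_act2 h & state n.+1 w = h.2].
Proof.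
split=> [<-|[]].
  split=> //; rewrite /hist_init /hist_act1 /hist_act2 /hist /= ?tnth_mktuple//=.
  congr pair; apply: eq_from_tnth => m.
  by rewrite !tnth_mktuple.
case: h => t x hE; rewrite /hist_act1 /hist_act2 /= => aE bE <-.
have /= sE := congr1 snd hE.
congr pair; apply: eq_from_tnth => m.
rewrite tnth_mktuple; case: (unliftP ord_max m) => [j|] ->.
  have := congr1 (fun u => tnth u j) (congr1 fst hE); rewrite !tnth_mktuple.
  have -> : lift ord_max j = widen_ord (leqnSn n) j.
    by apply: val_inj; rewrite /= /bump leqNgt ltn_ord.
  by [].
by rewrite /= sE aE bE; case: (tnth t ord_max) => -[].
Qed.

Lemma measurable_hist n (h : history S A B n) :
  measurable ([set w | hist n w = h] : set Omega).
Proof.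
elim: n h => [|n IHn] h.
  rewrite (_ : [set w | _] = [set w | state 0 w = h.2]).
    exact: measurable_state.
  apply/seteqP; split=> w /=; first by move=> <-.
  by case: h => t x /= <-; congr pair; apply: eq_from_tnth => -[].
rewrite (_ : [set w | _] = [set w | hist n w = hist_init h] `&`
   [set w | act1 n w = hist_act1 h] `&` [set w | act2 n w = hist_act2 h] `&`
   [set w | state n.+1 w = h.2]); last first.
  apply/seteqP; split=> w /=; first by move=> /hist_succP[].
  by move=> [[[? ?] ?] ?]; apply/hist_succP.
apply: measurableI; last exact: measurable_state.
apply: measurableI; last exact: measurable_act2.
by apply: measurableI; [exact: IHn|exact: measurable_act1].
Qed.

(** Intersected with [T_n <= s], these events are generators of [sigma_state n], and the
    [play_event]s below are generators of [sigma_action n]; the conditional laws are tested on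
    them. *)
Definition past_event n k (h : history S A B n) : set Omega :=
  [set w | kappa w = k /\ hist n w = h].

Definition play_event n k (h : history S A B n) a b : set Omega :=
  [set w | [/\ kappa w = k, hist n w = h, act1 n w = a & act2 n w = b]].

Lemma measurable_past_event n k (h : history S A B n) :
  measurable (past_event k h).
Proof.
by apply: measurableI; [exact: measurable_kappa|exact: measurable_hist].
Qed.

Lemma play_eventE n k (h : history S A B n) a b :
  play_event k h a b =
  past_event k h `&` ([set w | act1 n w = a] `&` [set w | act2 n w = b]).
Proof. by apply/seteqP; split=> [w []//|w [[? ?] [? ?]]]; split. Qed.

Lemma measurable_play_event n k (h : history S A B n) a b :
  measurable (play_event k h a b).
Proof.
rewrite play_eventE; apply: measurableI; first exact: measurable_past_event.
by apply: measurableI; [exact: measurable_act1|exact: measurable_act2].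
Qed.

Lemma past_event_succ n k (h : history S A B n.+1) :
  past_event k h = play_event k (hist_init h) (hist_act1 h) (hist_act2 h) `&`
                   [set w | state n.+1 w = h.2].
Proof.
apply/seteqP; split=> [w [kE /hist_succP[]]//|w [[? ? ? ?] ?]].
by split => //; apply/hist_succP.
Qed.

End coordinate_measurability.

(** * Law of the history weighted by the discount factor *)

Section laplace_kernel.
Context (R : realType) (S A B : finPointedType).
Context (Q : R -> S -> S -> A -> B -> R) (alpha : R).
Local Notation mu := (@lebesgue_measure R).

(* [Q] carries no information at negative times; the extension by 0 is monotone
   on the whole line. *)
Definition kernel_ext j x a b (t : R) : R := if 0 <= t then Q t j x a b else 0.

(** In layer-cake form, the Laplace-Stieltjes transform of [Q(dt, j | x, a, b)] at [alpha]. *)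
Definition laplace_kernel j x a b : R := fine (\int[mu]_t
  (alpha * expR (- (alpha * t)) * kernel_ext j x a b t)%:E).

Hypothesis hQ : semi_markov_kernel Q.
Hypothesis alpha_gt0 : 0 < alpha.

Lemma kernel_ext_ge0 j x a b t : 0 <= kernel_ext j x a b t.
Proof. by rewrite /kernel_ext; case: ifPn => // t0; exact: smk_ge0. Qed.

Lemma kernel_ext_le1 j x a b t : kernel_ext j x a b t <= 1.
Proof.
rewrite /kernel_ext; case: ifPn => // t0.
apply: le_trans (smk_le1 hQ x a b t0); rewrite (bigD1 j)//= lerDl.
by apply: sumr_ge0 => *; exact: smk_ge0.
Qed.

Lemma kernel_ext_homo j x a b : {homo kernel_ext j x a b : s t / s <= t}.
Proof.
move=> s t st; rewrite /kernel_ext; case: ifPn => s0.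
  by rewrite (le_trans s0 st); exact: smk_homo.
by case: ifPn => // t0; exact: smk_ge0.
Qed.

(** [fine] loses nothing: [kernel_ext] is at most 1 and vanishes at negative times, so the
    exponential density on [[0, +oo[], of mass 1, dominates the integrand. *)
Lemma laplace_kernelE j x a b :
  (laplace_kernel j x a b)%:E = (\int[mu]_t
    (alpha * expR (- (alpha * t)) * kernel_ext j x a b t)%:E)%E.
Proof.
have f0 t : (0 <= (alpha * expR (- (alpha * t)) * kernel_ext j x a b t)%:E)%E.
  by rewrite lee_fin !mulr_ge0 ?kernel_ext_ge0 ?expR_ge0// ltW.
rewrite /laplace_kernel fineK// ge0_fin_numE; last exact: integral_ge0.
apply: (@le_lt_trans _ _ (\int[mu]_(t in `[0%R, +oo[)
    (alpha * expR (- (alpha * t)))%:E)%E); last first.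
  by rewrite integral_exp_tail// ltry.
rewrite [leRHS]integral_mkcond; apply: ge0_le_integral => //.
- apply/measurable_EFinP; apply: measurable_funM.
    by apply: measurable_funM => //; exact: measurable_expRNM.
  by apply: nondecreasing_measurable => //; exact: kernel_ext_homo.
- apply/(measurable_restrictT _ _).1 => //; apply/measurable_EFinP.
  apply: measurable_funM => //.
  exact: (measurable_funS measurableT _ (@measurable_expRNM _ alpha)).
- move=> t _; rewrite patchE mem_setE in_itv/= andbT.
  rewrite /kernel_ext; case: ifPn => t0; last by rewrite mulr0.
  rewrite lee_fin ler_piMr//; first by rewrite mulr_ge0 ?expR_ge0// ltW.
  by have := kernel_ext_le1 j x a b t; rewrite /kernel_ext t0.
Qed.

End laplace_kernel.

(** * Recursion for the discounted law of the history under the game law *)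

Section law.
Context (R : realType) (K S A B : finPointedType).
Local Notation Omega := (Omega R K S A B).
Context (Q : R -> S -> S -> A -> B -> R) (alpha : R).
Hypothesis hQ : semi_markov_kernel Q.
Hypothesis alpha_gt0 : 0 < alpha.
Context (p : fdist R K) (i : S).
Context (pi : policy1 R K S A B) (sigma : policy2 R S A B).
Context (P : probability Omega R) (law : game_law Q p i pi sigma P).

(* The value of E[exp(- alpha T_n); kappa = k, H_n = h]: one factor per step,
   the only contribution of the policies being the probabilities of the
   actions recorded in h. *)
Fixpoint weight (tau : kernel2 R S A B) n (k : K) : history S A B n -> R :=
  match n with
  | 0%N => fun h => p k * (h.2 == i)%:R
  | n'.+1 => fun h =>
      pi k (hist_init h) (hist_act1 h) * tau n' (hist_init h) (hist_act2 h) *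
      laplace_kernel Q alpha h.2 (hist_init h).2 (hist_act1 h) (hist_act2 h) *
      weight tau k (hist_init h)
  end.

(** The version of the conditional probability in [law_action] is constant on the generator given by
    [k], [h] and [T_n <= s], so its integral there is a product. *)
Lemma law_play_event n k (h : history S A B n) a b s :
  P (play_event k h a b `&` [set w | jump_time n w <= s]) =
  ((pi k h a * sigma h b)%:E *
   P (past_event k h `&` [set w | (jump_time n w <= s)%R]))%E.
Proof.
have [_ lawE] := law_action law n a b.
rewrite play_eventE setIAC setIC lawE; last first.
  apply: sub_gen_smallest; exists k, h, [set t | t <= s]; split.
    by rewrite (_ : [set _ | _] = `]-oo, s]%classic).
  by apply/seteqP; split=> w [] // [].
rewrite (eq_integral (cst (pi k h a * sigma h b)%:E)).
  rewrite integral_cst//; apply: measurableI; first exact: measurable_past_event.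
  by apply: measurable_sublevel; exact: measurable_jump_time.
by move=> w; rewrite inE => -[[/= -> ->] _].
Qed.

Lemma law_jump_event n k (h : history S A B n) a b j s t :
  P (play_event k h a b `&` [set w | state n.+1 w = j] `&`
      [set w | sojourn n w <= t] `&` [set w | jump_time n w <= s]) =
  ((kernel_ext Q j h.2 a b t)%:E *
   P (play_event k h a b `&` [set w | (jump_time n w <= s)%R]))%E.
Proof.
(* For negative [t] both sides vanish, as sojourns are nonnegative. *)
rewrite /kernel_ext; case: ifPn => t0; last first.
  rewrite mul0e (_ : _ `&` _ = set0) ?measure0//.
  apply/seteqP; split=> // w [[_ /= wt] _].
  by move: t0; rewrite (le_trans (sojourn_ge0 n w) wt).
have [_ lawE] := law_jump law n j t0.
transitivity (P ([set w | jump_time n.+1 w - jump_time n w <= t /\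
    state n.+1 w = j] `&` (play_event k h a b `&` [set w | jump_time n w <= s]))).
  congr (P _); apply/seteqP; split=> w /=; rewrite jump_timeS addrAC subrr add0r.
    by move=> [[[? ?] ?] ?].
  by move=> [[? ?] [? ?]].
rewrite lawE; last first.
  apply: sub_gen_smallest; exists k, h, [set t | t <= s], a, b; split.
    by rewrite (_ : [set _ | _] = `]-oo, s]%classic).
  by apply/seteqP; split=> w [] // [].
rewrite (eq_integral (cst (Q t j h.2 a b)%:E)).
  rewrite integral_cst//; apply: measurableI; first exact: measurable_play_event.
  by apply: measurable_sublevel; exact: measurable_jump_time.
by move=> w; rewrite inE => -[[/= _ <- -> ->] _].
Qed.

Lemma laplace_play_event n k (h : history S A B n) a b :
  (\int[P]_(w in play_event k h a b) (expR (- (alpha * jump_time n w)))%:E =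
   (pi k h a * sigma h b)%:E *
   \int[P]_(w in past_event k h) (expR (- (alpha * jump_time n w)))%:E)%E.
Proof.
apply: laplace_proportional => //.
- exact: measurable_play_event.
- exact: measurable_past_event.
- exact: measurable_jump_time.
- by rewrite mulr_ge0// fdist_ge0.
- by move=> s; exact: law_play_event.
Qed.

(** The discount factor at [T_(n+1)] is the one at [T_n] times that of the sojourn, and by
    [law_jump_event] the pair of sojourn and next state is independent of [T_n] on the play
    event. *)
Lemma laplace_jump_event n k (h : history S A B n) a b j :
  (\int[P]_(w in play_event k h a b `&` [set w | state n.+1 w = j])
     (expR (- (alpha * jump_time n.+1 w)))%:E =
   (laplace_kernel Q alpha j h.2 a b)%:E *
   \int[P]_(w in play_event k h a b) (expR (- (alpha * jump_time n w)))%:E)%E.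
Proof.
under eq_integral do rewrite jump_timeS mulrDr opprD expRD.
rewrite laplace_kernelE//; apply: laplace_independent => //.
- apply: measurableI; first exact: measurable_play_event.
  exact: measurable_state.
- exact: measurable_play_event.
- exact: measurable_jump_time.
- exact: measurable_sojourn.
- exact: kernel_ext_homo.
- by move=> t; exact: kernel_ext_ge0.
- by move=> s t; exact: law_jump_event.
Qed.

(** [law_init] speaks only of the state [i]. Its masses sum to 1 over the types, so the play starts
    in [i] almost surely and other states get mass 0. *)
Lemma law_init_state k x :
  P [set w | kappa w = k /\ state 0 w = x] = (p k * (x == i)%:R)%:E.
Proof.
have -> : [set w | kappa w = k /\ state 0 w = x] =
          [set w : Omega | state 0 w = x /\ kappa w = k].
  by apply/seteqP; split=> w [].
have [->|xi] := eqVneq x i; first by rewrite mulr1 (law_init law).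
have mI y k' : measurable ([set w | state 0 w = y /\ kappa w = k'] : set Omega).
  by apply: measurableI; [exact: measurable_state|exact: measurable_kappa].
have Pi : P [set w | state 0 w = i] = 1%E.
  transitivity (\sum_k
      \int[P]_(w in [set w | state 0 w = i] `&` [set w | kappa w = k]) 1)%E.
    rewrite -ge0_integral_finite_partition//.
    - by rewrite integral_cst ?mul1e//; exact: measurable_state.
    - exact: measurable_state.
    - exact: measurable_kappa.
  transitivity (\sum_k (p k)%:E)%E; last by rewrite sumEFin fdist_sum1.
  apply: eq_bigr => k' _.
  by rewrite integral_cst ?mul1e; [exact: law_init law k'|exact: mI].
apply/eqP; rewrite mulr0 eq_le measure_ge0 andbT.
apply: (@le_trans _ _ (P (~` [set w | state 0 w = i]))); last first.
  by rewrite probability_setC ?Pi ?subee//; exact: measurable_state.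
apply: le_measure; rewrite ?inE.
- exact: mI.
- by apply: measurableC; exact: measurable_state.
- by move=> w [/= -> _]; apply/eqP.
Qed.

Lemma laplace_past_event n k (h : history S A B n) :
  (\int[P]_(w in past_event k h) (expR (- (alpha * jump_time n w)))%:E =
   (weight (kernel2_of_policy sigma) k h)%:E)%E.
Proof.
elim: n h => [|n IHn] h.
  under eq_integral do rewrite jump_time0 mulr0 oppr0 expR0.
  rewrite integral_cst ?mul1e; last exact: measurable_past_event.
  rewrite /= -law_init_state; congr (P _); apply/seteqP; split=> w /=.
    by move=> [? <-].
  by case: h => t x /= [? <-]; split=> //; congr pair; apply: eq_from_tnth => -[].
rewrite past_event_succ laplace_jump_event laplace_play_event IHn /= -!EFinM.
by congr EFin; rewrite mulrCA !mulrA.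
Qed.

(** * Stage rewards and their expectations *)

Context (c : K -> S -> A -> B -> R).
Hypothesis c_ge0 : forall k x a b, 0 <= c k x a b.

(** The integral of [exp(-alpha t)] times the payoff rate, which is constant there, over [[T_n,
    T_(n+1)[]. *)
Definition stage_reward n (w : Omega) : R :=
  c (kappa w) (state n w) (act1 n w) (act2 n w) *
  ((expR (- (alpha * jump_time n w)) - expR (- (alpha * jump_time n.+1 w))) /
   alpha).

(** The last factor is the conditional mean of [1 - exp(-alpha t_(n+1))] after the play
    [(k, h, a, b)]. The sum is finite and polynomial in finitely many values of [tau]. *)
Definition stage_payoff (tau : kernel2 R S A B) n : R :=
  \sum_(x : K * (n.-tuple (S * A * B) * S) * A * B)
    let: (k, h, a, b) := x in
    c k h.2 a b / alpha * (pi k h a * tau n h b * weight tau k h) *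
    (1 - \sum_j laplace_kernel Q alpha j h.2 a b).

Let exp_jump_ge n (w : Omega) :
  expR (- (alpha * jump_time n.+1 w)) <= expR (- (alpha * jump_time n w)).
Proof. by rewrite ler_expR lerN2 ler_pM2l// jump_time_homo. Qed.

Lemma stage_reward_ge0 n w : 0 <= stage_reward n w.
Proof.
rewrite mulr_ge0// mulr_ge0 ?invr_ge0 ?subr_ge0 ?exp_jump_ge//; exact: ltW.
Qed.

Let measurable_exp_jump D n :
  measurable_fun D (fun w : Omega => expR (- (alpha * jump_time n w))).
Proof.
apply: (measurable_funS measurableT) => //.
exact: (measurableT_comp (measurable_expRNM alpha) (measurable_jump_time n)).
Qed.

Definition situation n (w : Omega) : K * (n.-tuple (S * A * B) * S) * A * B :=
  (kappa w, hist n w, act1 n w, act2 n w).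

Lemma situationE n k (h : history S A B n) a b :
  [set w | situation n w = (k, h, a, b)] = play_event k h a b.
Proof.
apply/seteqP; split=> w; first by rewrite /situation /= => -[<- <- <- <-].
by move=> [? ? ? ?]; congr (_, _, _, _).
Qed.

Let stage_rewardE n k (h : history S A B n) a b w : play_event k h a b w ->
  stage_reward n w = c k h.2 a b / alpha *
    (expR (- (alpha * jump_time n w)) - expR (- (alpha * jump_time n.+1 w))).
Proof.
by move=> [<- <- <- <-]; rewrite /stage_reward [_ / alpha]mulrC mulrA.
Qed.

Lemma measurable_stage_reward n : measurable_fun setT (stage_reward n).
Proof.
apply: (@measurable_fun_finite_partition _ _ _ _ _ (situation n)).
  by move=> [[[k h] a] b]; rewrite situationE; exact: measurable_play_event.
move=> [[[k h] a] b]; rewrite situationE.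
have mg : measurable_fun (play_event k h a b) (fun w => c k h.2 a b / alpha *
    (expR (- (alpha * jump_time n w)) - expR (- (alpha * jump_time n.+1 w)))).
  by apply: measurable_funM => //; exact: measurable_funB.
by apply: eq_measurable_fun mg => w; rewrite inE => /stage_rewardE ->.
Qed.

Lemma stage_reward_play_event n k (h : history S A B n) a b :
  (\int[P]_(w in play_event k h a b) (stage_reward n w)%:E =
   (c k h.2 a b / alpha *
    (pi k h a * sigma h b * weight (kernel2_of_policy sigma) k h) *
    (1 - \sum_j laplace_kernel Q alpha j h.2 a b))%:E)%E.
Proof.
have mF := @measurable_play_event R K S A B n k h a b.
set F := play_event k h a b in mF *.
set W := pi k h a * sigma h b * weight (kernel2_of_policy sigma) k h.
have I1 : (\int[P]_(w in F) (expR (- (alpha * jump_time n w)))%:E = W%:E)%E.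
  by rewrite laplace_play_event laplace_past_event -EFinM.
have I2 : (\int[P]_(w in F) (expR (- (alpha * jump_time n.+1 w)))%:E =
    (\sum_j laplace_kernel Q alpha j h.2 a b * W)%:E)%E.
  rewrite (@ge0_integral_finite_partition _ _ _ P _ (@state R K S A B n.+1))//=.
  - rewrite -sumEFin; apply: eq_bigr => j _.
    by rewrite laplace_jump_event I1.
  - exact: measurable_state.
  - exact/measurable_EFinP.
have I12 : (\int[P]_(w in F) (expR (- (alpha * jump_time n w)) -
     expR (- (alpha * jump_time n.+1 w)))%:E =
    (W - \sum_j laplace_kernel Q alpha j h.2 a b * W)%:E)%E.
  (* Additivity is used on nonnegative integrands, the difference and the later discount factor; the
     finite integral [I2] is then subtracted. *)
  rewrite EFinB -I1 -I2; apply/esym.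
  rewrite -[RHS](@addeK _ (\int[P]_(w in F)
    (expR (- (alpha * jump_time n.+1 w)))%:E)%E); last by rewrite I2.
  congr (_ - _)%E; rewrite -ge0_integralD//=.
  - by apply: eq_integral => w _; rewrite -EFinD subrK.
  - by move=> w _; rewrite lee_fin subr_ge0.
  - by apply/measurable_EFinP; exact: measurable_funB.
  - exact/measurable_EFinP.
transitivity (\int[P]_(w in F) ((c k h.2 a b / alpha)%:E *
    (expR (- (alpha * jump_time n w)) - expR (- (alpha * jump_time n.+1 w)))%:E))%E.
  by apply: eq_integral => w; rewrite inE => /stage_rewardE ->.
rewrite ge0_integralZl//=.
- rewrite I12 -EFinM; congr EFin.
  by rewrite -mulr_suml; ring.
- by apply/measurable_EFinP; exact: measurable_funB.
- by move=> w _; rewrite lee_fin subr_ge0.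
- by rewrite lee_fin divr_ge0// ltW.
Qed.

Lemma expected_stage_reward n :
  (\int[P]_w (stage_reward n w)%:E =
   (stage_payoff (kernel2_of_policy sigma) n)%:E)%E.
Proof.
rewrite (@ge0_integral_finite_partition _ _ _ P _ (situation n))//=.
- rewrite /stage_payoff -sumEFin; apply: eq_bigr => -[[[k h] a] b] _.
  by rewrite setTI situationE stage_reward_play_event.
- by move=> [[[k h] a] b]; rewrite situationE; exact: measurable_play_event.
- by apply/measurable_EFinP; exact: measurable_stage_reward.
- by move=> w _; rewrite lee_fin stage_reward_ge0.
Qed.

(** * The payoff as a series over the stages *)

Lemma lt_explosion_timeP (w : Omega) (t : R) :
  (t%:E < explosion_time w)%E <-> exists n, t < jump_time n w.
Proof.
have nd : {homo (fun n => (jump_time n w)%:E) : m n / (m <= n)%N >-> (m <= n)%E}.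
  by move=> m n mn; rewrite lee_fin jump_time_homo.
rewrite /explosion_time (cvg_lim _ (ereal_nondecreasing_cvgn nd))//.
split=> [/ereal_sup_gt[_ [n _ <-]]|[n tn]]; first by rewrite lte_fin; exists n.
apply: (@lt_le_trans _ _ (jump_time n w)%:E); first by rewrite lte_fin.
by apply: ereal_sup_ubound; exists n.
Qed.

Lemma jump_indexE n (w : Omega) (t : R) :
  jump_time n w <= t < jump_time n.+1 w -> jump_index w t = n.
Proof.
move=> nt; rewrite /jump_index; case: xgetP => [m _ /= mt|/(_ n)//].
have [nm|mn|//] := ltngtP n m.
- move: nt mt => /andP[_ tn] /andP[mt _].
  by have := lt_le_trans tn (le_trans (jump_time_homo w nm) mt); rewrite ltxx.
- move: nt mt => /andP[nt _] /andP[_ tm].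
  by have := lt_le_trans tm (le_trans (jump_time_homo w mn) nt); rewrite ltxx.
Qed.

(** The intervals [[T_n, T_(n+1)[] partition [[0, T_infty[], those of zero sojourn being empty, and
    [jump_index] is [n] on the [n]-th. *)
Lemma discounted_payoffE w :
  (discounted_payoff c alpha w = \sum_(n <oo) (stage_reward n w)%:E)%E.
Proof.
rewrite /discounted_payoff.
pose I n := `[jump_time n w, jump_time n.+1 w[%classic : set R.
have IE : [set t : R | (0 <= t)%R /\ (t%:E < explosion_time w)%E] =
    \bigcup_n I n.
  apply/seteqP; split=> t /=.
    move=> [t0 /lt_explosion_timeP ex].
    (* The least index whose jump time exceeds [t] is not 0, since [T_0 = 0 <= t]; its predecessor
       is the stage containing [t]. *)
    have [[|n] tn nmin] := ex_minnP ex.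
      by move: tn; rewrite jump_time0 ltNge t0.
    exists n => //=; rewrite /I /= in_itv/= tn andbT leNgt; apply/negP => /nmin.
    by rewrite ltnn.
  move=> [n _]; rewrite /I /= in_itv/= => /andP[nt tn]; split.
    exact: le_trans (jump_time_ge0 n w) nt.
  by apply/lt_explosion_timeP; exists n.+1.
pose r n := c (kappa w) (state n w) (act1 n w) (act2 n w).
have onI n t : I n t ->
  expR (- (alpha * t)) * c (kappa w) (state (jump_index w t) w)
    (act1 (jump_index w t) w) (act2 (jump_index w t) w) =
  r n * expR (- (alpha * t)).
  by rewrite /I /= in_itv/= => /jump_indexE ->; rewrite mulrC.
have me n : measurable_fun (I n) (fun t => expR (- (alpha * t))).
  exact: (measurable_funS measurableT _ (@measurable_expRNM _ alpha)).
rewrite IE ge0_integral_bigcup//=.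
- apply: eq_eseriesr => n _.
  transitivity (\int[lebesgue_measure]_(t in I n)
      ((r n)%:E * (expR (- (alpha * t)))%:E))%E.
    by apply: eq_integral => t; rewrite inE => /onI ->.
  rewrite ge0_integralZl//=.
  - by rewrite integral_exp_itv// ?jump_time_homo// -EFinM.
  - exact: measurable_itv.
  - by apply/measurable_EFinP; exact: me.
  - by rewrite lee_fin; exact: c_ge0.
- by move=> n; exact: measurable_itv.
- apply/measurable_fun_bigcup => n; first exact: measurable_itv.
  apply/measurable_EFinP.
  have mr : measurable_fun (I n) (fun t => r n * expR (- (alpha * t))).
    by apply: measurable_funM => //; exact: me.
  by apply: eq_measurable_fun mr => t; rewrite inE => /onI ->.
- by move=> t _; rewrite lee_fin mulr_ge0// expR_ge0.
- apply/trivIsetP => m n _ _ mn; apply/seteqP; split=> // t [].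
  rewrite /I /= !in_itv/= => /jump_indexE mE /jump_indexE nE.
  by move: mn; rewrite -mE nE eqxx.
Qed.

(** Monotone convergence exchanges sum and expectation. A supremum of partial sums is the form that
    [policy2_min_sup] accepts. *)
Lemma expected_discounted_payoff :
  (\int[P]_w discounted_payoff c alpha w =
   ereal_sup [set (\sum_(n < N) stage_payoff (kernel2_of_policy sigma) n)%:E
             | N in [set: nat]])%E.
Proof.
under eq_integral do rewrite discounted_payoffE.
rewrite integral_nneseries//; last 2 first.
- by move=> n; apply/measurable_EFinP; exact: measurable_stage_reward.
- by move=> n w _; rewrite lee_fin stage_reward_ge0.
have u0 n : (0 <= (stage_payoff (kernel2_of_policy sigma) n)%:E)%E.
  rewrite -expected_stage_reward; apply: integral_ge0 => w _.
  by rewrite lee_fin stage_reward_ge0.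
under eq_eseriesr do rewrite expected_stage_reward.
apply/cvg_lim => //.
rewrite (_ : [set _ | _ in _] = range (fun N => \sum_(0 <= n < N)
    (stage_payoff (kernel2_of_policy sigma) n)%:E)%E); last first.
  by apply: eq_imagel => N _; rewrite sumEFin big_mkord.
apply: ereal_nondecreasing_cvgn => m n mn.
exact: lee_sum_nneg_natr.
Qed.

End law.

(** * Dependence of the payoff on the policy of Player 2 *)

Section policy2_dependence.
Context (R : realType) (K S A B : finPointedType).
Context (Q : R -> S -> S -> A -> B -> R) (c : K -> S -> A -> B -> R).
Context (alpha : R).
Context (p : fdist R K) (i : S) (pi : policy1 R K S A B).

Lemma continuous_weight n k (h : history S A B n) :
  continuous (fun f : prod_topology (fun _ : choice_point S A B => R^o) =>
    weight Q alpha p i pi (kernel2_of_coord f) k h : R).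
Proof.
elim: n h => [|n IHn] h; first exact: cst_continuous.
apply: continuous_mul; last exact: (IHn (hist_init h)).
apply: continuous_mul; last exact: cst_continuous.
apply: continuous_mul; first exact: cst_continuous.
exact: continuous_kernel2_of_coord.
Qed.

Lemma continuous_stage_payoff n :
  continuous (fun f : prod_topology (fun _ : choice_point S A B => R^o) =>
    stage_payoff Q alpha p i pi c (kernel2_of_coord f) n : R).
Proof.
apply: continuous_sum => -[[[k h] a] b].
apply: continuous_mul; last exact: cst_continuous.
apply: continuous_mul; first exact: cst_continuous.
apply: continuous_mul; last exact: continuous_weight.
apply: continuous_mul; first exact: cst_continuous.
exact: continuous_kernel2_of_coord.
Qed.

(** The initial state, reached by the same recursion through [hist_init] as in [weight]. *)
Fixpoint hist_first n : history S A B n -> S :=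
  match n with
  | 0%N => fun h => h.2
  | n'.+1 => fun h => hist_first (hist_init h)
  end.

Lemma weight_hist_first tau n k (h : history S A B n) :
  hist_first h != i -> weight Q alpha p i pi tau k h = 0.
Proof.
elim: n h => [|n IHn] h /= hi; first by rewrite (negPf hi) mulr0.
by rewrite IHn// mulr0.
Qed.

(** Histories that do not start in [i] carry weight 0, so the values of [tau] there are multiplied
    by 0. *)
Lemma eq_stage_payoff (tau tau' : kernel2 R S A B) n :
  (forall m (h : history S A B m) b, hist_first h = i -> tau m h b = tau' m h b) ->
  stage_payoff Q alpha p i pi c tau n = stage_payoff Q alpha p i pi c tau' n.
Proof.
move=> tauE.
have weightE m k (h : history S A B m) :
    weight Q alpha p i pi tau k h = weight Q alpha p i pi tau' k h.
  elim: m h => [//|m IHm] h /=; rewrite IHm.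
  have [hi|hi] := eqVneq (hist_first (hist_init h)) i; first by rewrite tauE.
  by rewrite (weight_hist_first _ _ hi) !mulr0.
apply: eq_bigr => -[[[k h] a] b] _; rewrite weightE.
have [hi|hi] := eqVneq (hist_first h) i; first by rewrite tauE.
by rewrite (weight_hist_first _ _ hi) !mulr0.
Qed.

End policy2_dependence.

(** * Minimizers for each initial state and their gluing *)

Theorem theorem5p9 (R : realType) (K S A B : finPointedType)
    (Q : R -> S -> S -> A -> B -> R) (c : K -> S -> A -> B -> R) (alpha : R)
    (P : fdist R K -> S -> policy1 R K S A B -> policy2 R S A B ->
         probability (Omega R K S A B) R)
    (hQ : semi_markov_kernel Q)
    (hc : forall k i a b, 0 <= c k i a b)
    (halpha : 0 < alpha)
    (hP : forall p i pi sigma, game_law Q p i pi sigma (P p i pi sigma))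
    (delta eps : R) (hdelta : 0 < delta) (heps0 : 0 < eps) (heps1 : eps < 1)
    (hD : forall i a b, sojourn_cdf Q delta i a b <= 1 - eps)
    (p : fdist R K) :
  let V := expected_payoff c alpha P in
  exists sigma : policy2 R S A B,
    (forall Vstar : fdist R K -> S -> \bar R, is_value V Vstar ->
       forall (pi : policy1 R K S A B) (i : S),
         (V p i pi sigma <= Vstar p i)%E) /\
    optimal2 V p sigma.
Proof.
move=> V.
(* The index pairs a policy of Player 1 with a truncation horizon, so that the supremum over
   policies of suprema of partial sums becomes one supremum of continuous functions. *)
pose W i (x : policy1 R K S A B * nat) tau :=
  \sum_(n < x.2) stage_payoff Q alpha p i x.1 c tau n.
have VW i sigma :
    ereal_sup [set V p i pi sigma | pi in [set: policy1 R K S A B]] =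
    ereal_sup [set (W i x (kernel2_of_policy sigma))%:E | x in setT].
  have VE pi : V p i pi sigma = ereal_sup [set
      (W i (pi, N) (kernel2_of_policy sigma))%:E | N in [set: nat]].
    exact: expected_discounted_payoff (hP p i pi sigma) _ hc.
  apply/eqP; rewrite eq_le; apply/andP; split; apply: ge_ereal_sup => _ [x _ <-].
    rewrite VE; apply: ge_ereal_sup => _ [N _ <-].
    by apply: ereal_sup_ubound; exists (x, N).
  apply: (@le_trans _ _ (V p i x.1 sigma)).
    by rewrite VE; apply: ereal_sup_ubound; exists x.2 => //; case: x.
  by apply: ereal_sup_ubound; exists x.1.
have opt i : exists sigma : policy2 R S A B, forall sigma',
    (ereal_sup [set V p i pi sigma | pi in [set: policy1 R K S A B]] <=
     ereal_sup [set V p i pi sigma' | pi in [set: policy1 R K S A B]])%E.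
  have [x|sigma sigma_min] := @policy2_min_sup R S A B _ (W i).
    by apply: continuous_sum => n; exact: continuous_stage_payoff.
  by exists sigma => sigma'; rewrite !VW.
have [best bestP] := choice opt.
(* Player 2 observes the initial state and follows the minimizer chosen for it. *)
pose sigma : policy2 R S A B := fun n h => best (hist_first h) n h.
have sigma_opt : optimal2 V p sigma.
  move=> i; apply: le_ereal_inf_tmp => _ [sigma' _ <-].
  apply: le_trans (bestP i sigma'); rewrite !VW.
  rewrite (_ : [set _ | _ in _] =
    [set (W i x (kernel2_of_policy (best i)))%:E | x in setT])//.
  apply: eq_imagel => x _; congr EFin; apply: eq_bigr => n _.
  by apply: eq_stage_payoff => m h b hi; rewrite /kernel2_of_policy /sigma hi.
exists sigma; split=> // Vstar VstarP pi i.
have [_ <-] := VstarP p i; apply: le_trans (sigma_opt i).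
by apply: ereal_sup_ubound; exists pi.
Qed.
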